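(* Let $k$ be a field, $E=\bigwedge(k^n)$, let $F=\bigoplus_{i=1}^r Eg_i$ be a graded free $E$-module with $\deg g_i=d_i\in\mathbb Z$, let $M=I_1g_1\oplus\cdots\oplus I_rg_r\subseteq F$ be an ids-module (with $I_1,\dots,I_r\subseteq E$ graded ideals), and let $>$ be any monomial order on $F$. Then: (1) The initial submodule splits along the same decomposition, $$\operatorname{in}_>(M)=\operatorname{in}_>(I_1)g_1\oplus\cdots\oplus\operatorname{in}_>(I_r)g_r;$$ in particular $\operatorname{in}_>(M)$ is a monomial submodule, and an ids-module with the expected components. (2) $\operatorname{in}_>(M)$ is proper if and only if $M$ is; that is, $\operatorname{in}_>(M)$ is an Amata–Crupi monomial submodule exactly when $M$ is a proper ids-module.
   Context: $E=\bigwedge(k^n)$ is the exterior algebra on $e_1,\dots,e_n$, graded with $\deg e_i=1$; for $\sigma=\{s_1<\cdots<s_j\}\subseteq\{1,\dots,n\}$, $e_\sigma=e_{s_1}\wedge\cdots\wedge e_{s_j}$. The monomials of $F$ are the $e_\sigma g_i$, of degree $|\sigma|+d_i$. A monomial order on $F$ is (in the usual sense) a total order on these monomials compatible with multiplication by monomials of $E$ whenever the products are nonzero (signs ignored). For a graded submodule $M\subseteq F$, $\operatorname{in}_>(M)$ is the $k$-span of the leading monomials, with respect to $>$, of the nonzero elements of $M$. For a graded ideal $I_i\subseteq E$, $\operatorname{in}_>(I_i)$ is the $k$-span of the leading monomials of nonzero elements of $I_i$, where the order on the monomials of $E$ is the one induced from the restriction of $>$ to the monomials of $Eg_i$ (i.e.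 $e_\sigma>e_\tau$ iff $e_\sigma g_i>e_\tau g_i$). A graded submodule $M\subseteq F$ is an ids-module (ideal-direct-sum module) if $M=I_1g_1\oplus\cdots\oplus I_rg_r$ for graded ideals $I_i\subseteq E$; equivalently $M=\bigoplus_i(M\cap Eg_i)$. It is proper if $(I_i)_{\le 1}=0$ for every $i$. A monomial submodule is a submodule generated by monomials of $F$; it has the form $I_1g_1\oplus\cdots\oplus I_rg_r$ with the $I_i$ monomial ideals. An Amata–Crupi monomial submodule is a proper monomial submodule, i.e. one in which no $I_i$ has a minimal generator of degree $\le 1$. *)

(* Defs.v *)
From HB Require Import structures.
From mathcomp Require Import all_boot all_order all_algebra.
From mathcomp Require Import boolp.

Set Implicit Arguments.
Unset Strict Implicit.
Unset Printing Implicit Defensive.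

Import Order.TTheory GRing.Theory.
Local Open Scope ring_scope.

(* The exterior algebra of k^n, given by coordinates in its basis
   e_sigma, sigma ranging over the subsets of {0, ..., n-1}. *)
Definition ext (k : fieldType) (n : nat) : Type := {ffun {set 'I_n} -> k^o}.

HB.instance Definition _ (k : fieldType) (n : nat) :=
  Vector.copy (ext k n) {ffun {set 'I_n} -> k^o}.

Definition coord_at (k : fieldType) (n : nat) (a : ext k n) (s : {set 'I_n}) : k :=
  (a : {ffun {set 'I_n} -> k^o}) s.
Coercion coord_at : ext >-> Funclass.

Section ExteriorAlgebra.
Variables (k : fieldType) (n : nat).
Local Notation E := (ext k n).
Implicit Types (a b c : E) (s t u : {set 'I_n}).

Definition emon s : E := [ffun t => (t == s)%:R].

Definition inversions s t : nat :=
  (\sum_(i in s) \sum_(j in t) (j < i)%N)%N.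

(* e_s /\ e_t : sorting the concatenation of s and t costs one sign per
   inversion. *)
Definition emon_mul s t : E :=
  if [disjoint s & t] then (-1) ^+ inversions s t *: emon (s :|: t) else 0.

Definition ext_mul a b : E := \sum_s \sum_t (a s * b t) *: emon_mul s t.

Lemma extP a b : (forall s, a s = b s) -> a = b.
Proof. by move=> ab; apply/ffunP=> s; apply: ab. Qed.

Lemma coordD a b s : coord_at (a + b) s = a s + b s.
Proof. by rewrite /coord_at ffunE. Qed.

Lemma coordZ (x : k) a s : coord_at (x *: a) s = x * a s.
Proof. by rewrite /coord_at ffunE. Qed.

Lemma coord_emon s t : emon s t = (t == s)%:R.
Proof. by rewrite /coord_at ffunE. Qed.

Lemma ext_basis a : a = \sum_s a s *: emon s.
Proof.
apply: extP => t; rewrite /coord_at sum_ffunE (bigD1 t) //= big1 => [|s nst].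
  by rewrite addr0 !ffunE eqxx [RHS]mulr1.
by rewrite !ffunE eq_sym (negbTE nst) [LHS]mulr0.
Qed.

Lemma ext_mulDl : left_distributive ext_mul +%R.
Proof.
move=> a b c; rewrite /ext_mul -big_split /=; apply: eq_bigr => s _.
rewrite -big_split /=; apply: eq_bigr => t _.
by rewrite coordD mulrDl scalerDl.
Qed.

Lemma ext_mulDr : right_distributive ext_mul +%R.
Proof.
move=> a b c; rewrite /ext_mul -big_split /=; apply: eq_bigr => s _.
rewrite -big_split /=; apply: eq_bigr => t _.
by rewrite coordD mulrDr scalerDl.
Qed.

Lemma ext_scalerAl (x : k) a b : x *: ext_mul a b = ext_mul (x *: a) b.
Proof.
rewrite /ext_mul scaler_sumr; apply: eq_bigr => s _.
rewrite scaler_sumr; apply: eq_bigr => t _.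
by rewrite coordZ -mulrA scalerA.
Qed.

Lemma ext_scalerAr (x : k) a b : x *: ext_mul a b = ext_mul a (x *: b).
Proof.
rewrite /ext_mul scaler_sumr; apply: eq_bigr => s _.
rewrite scaler_sumr; apply: eq_bigr => t _.
by rewrite coordZ mulrCA scalerA.
Qed.

Lemma ext_mul0l b : ext_mul 0 b = 0.
Proof. by rewrite -[0 in LHS](scale0r (0 : E)) -ext_scalerAl scale0r. Qed.

Lemma ext_mul0r a : ext_mul a 0 = 0.
Proof. by rewrite -[0 in LHS](scale0r (0 : E)) -ext_scalerAr scale0r. Qed.

Lemma lin_ext (f g : E -> E) : linear f -> linear g ->
  (forall s, f (emon s) = g (emon s)) -> f =1 g.
Proof.
move=> lf lg fg a; pose h b := f b - g b.
have lh : linear h.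
  by move=> x u v; rewrite /h lf lg opprD addrACA scalerBr.
have h0 : h 0 = 0 by have := lh (-1) 0 0; rewrite scaler0 addr0 scaleN1r addNr.
have hD : {morph h : u v / u + v}.
  by move=> u v; have := lh 1 u v; rewrite !scale1r.
apply/subr0_eq; rewrite -/(h a) [a]ext_basis (big_morph h hD h0) big1 // => s _.
by rewrite -[_ *: _]addr0 lh h0 addr0 /h fg subrr scaler0.
Qed.

Lemma ext_mul_linl b : linear (fun a => ext_mul a b).
Proof. by move=> x u v; rewrite ext_mulDl ext_scalerAl. Qed.

Lemma ext_mul_linr a : linear (ext_mul a).
Proof. by move=> x u v; rewrite ext_mulDr ext_scalerAr. Qed.

Lemma ext_mul_emon s t : ext_mul (emon s) (emon t) = emon_mul s t.
Proof.
rewrite /ext_mul (bigD1 s) //= (bigD1 t) //= big1 ?big1 ?addr0 => [|u nu|u nu].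
- by rewrite !coord_emon !eqxx mulr1 scale1r.
- by rewrite big1 // => v _; rewrite coord_emon (negbTE nu) mul0r scale0r.
- by rewrite !coord_emon (negbTE nu) mulr0 scale0r.
Qed.

Lemma inversionsUl s t u :
  [disjoint s & t] -> inversions (s :|: t) u = (inversions s u + inversions t u)%N.
Proof. by move=> dst; rewrite /inversions (eq_bigl _ _ (fun i => in_setU i s t)) bigU. Qed.

Lemma inversionsUr s t u :
  [disjoint t & u] -> inversions s (t :|: u) = (inversions s t + inversions s u)%N.
Proof.
move=> dtu; rewrite /inversions -big_split /=; apply: eq_bigr => i _.
by rewrite (eq_bigl _ _ (fun j => in_setU j t u)) bigU.
Qed.

Lemma disjointsU s t u :
  [disjoint s :|: t & u] = [disjoint s & u] && [disjoint t & u].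
Proof. by rewrite -!setI_eq0 setIUl setU_eq0. Qed.

Lemma emon_mulA s t u :
  ext_mul (emon s) (emon_mul t u) = ext_mul (emon_mul s t) (emon u).
Proof.
rewrite /emon_mul; case: ifP => dtu; case: ifP => dst.
- rewrite -ext_scalerAr -ext_scalerAl !ext_mul_emon /emon_mul.
  rewrite disjointsU dtu andbT disjoint_sym disjointsU.
  rewrite [[disjoint t & s]]disjoint_sym dst /= [[disjoint u & s]]disjoint_sym.
  case: ifP => dsu; last by rewrite !scaler0.
  by rewrite !scalerA -!exprD inversionsUl // inversionsUr // setUA addnC -addnA.
- rewrite ext_mul0l -ext_scalerAr ext_mul_emon /emon_mul disjoint_sym disjointsU.
  by rewrite [[disjoint t & s]]disjoint_sym dst scaler0.
- by rewrite ext_mul0r -ext_scalerAl ext_mul_emon /emon_mul disjointsU dtu andbF scaler0.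
- by rewrite ext_mul0l ext_mul0r.
Qed.

Lemma ext_mulA : associative ext_mul.
Proof.
move=> a b c.
apply: (lin_ext (f := fun a => ext_mul a (ext_mul b c))
                (g := fun a => ext_mul (ext_mul a b) c)) => [|x u v|s].
- exact: ext_mul_linl.
- by rewrite !ext_mul_linl.
apply: (lin_ext (f := fun b => ext_mul (emon s) (ext_mul b c))
                (g := fun b => ext_mul (ext_mul (emon s) b) c)) => [x u v|x u v|t].
- by rewrite ext_mul_linl ext_mul_linr.
- by rewrite ext_mul_linr ext_mul_linl.
apply: (lin_ext (f := fun c => ext_mul (emon s) (ext_mul (emon t) c))
                (g := ext_mul (ext_mul (emon s) (emon t)))) => [x u v||u].
- by rewrite !ext_mul_linr.
- exact: ext_mul_linr.
by rewrite !ext_mul_emon emon_mulA.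
Qed.

Lemma ext_mul1l : left_id (emon set0) ext_mul.
Proof.
apply: lin_ext => // [|s]; first exact: ext_mul_linr.
rewrite ext_mul_emon /emon_mul -setI_eq0 set0I eqxx set0U.
by rewrite /inversions big_set0 expr0 scale1r.
Qed.

Lemma ext_mul1r : right_id (emon set0) ext_mul.
Proof.
apply: (lin_ext (f := fun a => ext_mul a (emon set0)) (g := id)) => // [|s].
  exact: ext_mul_linl.
rewrite ext_mul_emon /emon_mul -setI_eq0 setI0 eqxx setU0.
by rewrite /inversions big1 ?expr0 ?scale1r // => i _; rewrite big_set0.
Qed.

Lemma ext_oner_neq0 : emon set0 != 0.
Proof.
apply/eqP => /ffunP/(_ set0)/eqP.
by rewrite !ffunE eqxx oner_eq0.
Qed.

End ExteriorAlgebra.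

HB.instance Definition _ (k : fieldType) (n : nat) :=
  GRing.Zmodule_isNzRing.Build (ext k n) (@ext_mulA k n) (@ext_mul1l k n)
    (@ext_mul1r k n) (@ext_mulDl k n) (@ext_mulDr k n) (@ext_oner_neq0 k n).
HB.instance Definition _ (k : fieldType) (n : nat) :=
  GRing.Lmodule_isLalgebra.Build k (ext k n) (@ext_scalerAl k n).
HB.instance Definition _ (k : fieldType) (n : nat) :=
  GRing.Lalgebra_isAlgebra.Build k (ext k n) (@ext_scalerAr k n).

Section ExteriorAlgebraTheory.
Variables (k : fieldType) (n : nat).
Implicit Types (s t : {set 'I_n}).

Lemma emonM s t : emon k s * emon k t =
  if [disjoint s & t] then (-1) ^+ inversions s t *: emon k (s :|: t) else 0.
Proof. exact: ext_mul_emon. Qed.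

Lemma egen_sqr (i : 'I_n) : emon k [set i] * emon k [set i] = 0.
Proof. by rewrite emonM disjoints1 set11. Qed.

Lemma egen_anticomm (i j : 'I_n) :
  emon k [set i] * emon k [set j] = - (emon k [set j] * emon k [set i]).
Proof.
rewrite !emonM !disjoints1 !inE [j == i]eq_sym; case: eqP => [_|/eqP nij] /=.
  by rewrite oppr0.
rewrite /inversions !big_set1 setUC -scaleNr.
by case: ltngtP => [||/val_inj eij]; rewrite ?expr0 ?expr1 ?opprK //; rewrite eij eqxx in nij.
Qed.

(* enum lists the elements of an ordinal set in increasing order. *)
Lemma emon_prod s : emon k s = \prod_(i <- enum s) emon k [set i].
Proof.
have: sorted (fun i j : 'I_n => (i < j)%N) (enum s).
  rewrite /enum_mem; apply: sorted_filter => [x y z|]; first exact: ltn_trans.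
  have := iota_ltn_sorted 0 n; rewrite -val_enum_ord sorted_map.
  by rewrite enumT.
rewrite -{2}[s]set_enum; elim: (enum s) => [|i l IH] /=.
  by rewrite big_nil set_nil.
rewrite path_sortedE => [/andP[/allP li /IH IHl]|x y z]; last exact: ltn_trans.
have il : i \notin l by apply/negP => /li; rewrite ltnn.
rewrite big_cons -IHl emonM disjoints1 inE il /inversions big_set1.
rewrite set_cons big1 ?expr0 ?scale1r // => j; rewrite inE => /li ij.
by rewrite ltnNge ltnW.
Qed.

End ExteriorAlgebraTheory.

(* The free E-module F = E g_1 + ... + E g_r, by coordinates in the g_i. *)
Notation free_ext k n r := {ffun 'I_r -> ext k n}.

(* The pair (i, s) stands for the monomial e_s g_i. *)
Definition mon (n r : nat) : finType := ('I_r * {set 'I_n})%type.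

Section FreeModule.
Variables (k : fieldType) (n r : nat).
Local Notation E := (ext k n).
Local Notation F := (free_ext k n r).
Implicit Types (a : E) (f : F) (i : 'I_r) (u : mon n r).

Definition eact a f : F := [ffun i => a * f i].

Definition gen i : F := [ffun j => if j == i then 1 else 0].

Definition fmon u : F := eact (emon k u.2) (gen u.1).

Definition mcoef f u : k := f u.1 u.2.

Definition mulgen_fun f a : F := eact a f.

Fact mulgen_is_linear f : linear (mulgen_fun f).
Proof.
by move=> x a b; apply/ffunP=> i; rewrite !ffunE mulrDl scalerAl.
Qed.

HB.instance Definition _ f :=
  GRing.isLinear.Build k E F _ (mulgen_fun f) (mulgen_is_linear f).

Definition mulgen f : 'Hom(E, F) := linfun (mulgen_fun f).

Lemma mulgenE f a : mulgen f a = eact a f.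
Proof. exact: lfunE. Qed.

Lemma mcoef_fmon u v : mcoef (fmon u) v = (v == u)%:R.
Proof.
rewrite /mcoef /fmon !ffunE [v == u]/eq_op /=; case: eqP => _ /=.
  by rewrite mulr1 coord_emon.
by rewrite mulr0 /coord_at ffunE.
Qed.

End FreeModule.

(* Left ideals and left submodules: in the graded case these are two-sided,
   since b * a = (-1)^(|a| |b|) a * b for homogeneous a and b. *)
Section Graded.
Variables (k : fieldType) (n r : nat).
Local Notation E := (ext k n).
Local Notation F := (free_ext k n r).

Definition is_ideal (I : {vspace E}) : Prop :=
  forall a b : E, b \in I -> a * b \in I.

Definition is_submodule (M : {vspace F}) : Prop :=
  forall (a : E) (f : F), f \in M -> eact a f \in M.

Definition hcompE (j : nat) (a : E) : E :=
  [ffun s : {set 'I_n} => if #|s| == j then a s else 0].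

Definition mdeg (d : 'I_r -> int) (u : mon n r) : int := #|u.2|%:Z + d u.1.

Definition hcompF (d : 'I_r -> int) (j : int) (f : F) : F :=
  [ffun i => [ffun s => if mdeg d (i, s) == j then f i s else 0] : E].

Definition graded_ideal (I : {vspace E}) : Prop :=
  is_ideal I /\ forall (j : nat) (a : E), a \in I -> hcompE j a \in I.

Definition graded_submodule (d : 'I_r -> int) (M : {vspace F}) : Prop :=
  is_submodule M /\ forall (j : int) (f : F), f \in M -> hcompF d j f \in M.

(* The sum of the graded pieces of E of degree at most m. *)
Definition ext_le (m : nat) : {vspace E} :=
  <<[seq emon k s | s in [pred s : {set 'I_n} | (#|s| <= m)%N]]>>%VS.

(* M is an ids-module with components I i. *)
Definition ids_decomposition (d : 'I_r -> int) (M : {vspace F})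
    (I : 'I_r -> {vspace E}) : Prop :=
  [/\ graded_submodule d M,
      forall i, graded_ideal (I i),
      M = (\sum_i (mulgen (gen k n i) @: I i))%VS
    & directv (\sum_i (mulgen (gen k n i) @: I i))%VS].

(* The I i below are determined by M. *)
Definition proper_ids (d : 'I_r -> int) (M : {vspace F}) : Prop :=
  exists2 I, ids_decomposition d M I & forall i, (I i :&: ext_le 1 = 0)%VS.

Definition monomial_submodule (M : {vspace F}) : Prop :=
  exists U : {set mon n r}, M = (\sum_(u in U) (mulgen (fmon k u) @: fullv))%VS.

Definition amata_crupi (d : 'I_r -> int) (M : {vspace F}) : Prop :=
  monomial_submodule M /\ proper_ids d M.

End Graded.

(* The product of e_s and a monomial, up to sign, when it is nonzero
   (eact_fmon). *)
Definition mon_mul (n r : nat) (s : {set 'I_n}) (u : mon n r) : mon n r :=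
  (u.1, s :|: u.2).

Lemma eact_fmon (k : fieldType) (n r : nat) (s : {set 'I_n}) (u : mon n r) :
  eact (emon k s) (fmon k u) =
  if [disjoint s & u.2]
  then (-1) ^+ inversions s u.2 *: fmon k (mon_mul s u) else 0.
Proof.
apply/ffunP=> i; rewrite !ffunE mulrA emonM.
by case: ifP => _; rewrite !ffunE ?mul0r // scalerAl.
Qed.

(* le is the non-strict form of the order. Compatibility for the strict form
   follows, since mon_mul s is injective on the monomials not killed by e_s. *)
Definition monomial_order (k : fieldType) (n r : nat) (le : rel (mon n r)) : Prop :=
  [/\ reflexive le, antisymmetric le, transitive le, total le
    & forall (s : {set 'I_n}) (u v : mon n r),
        eact (emon k s) (fmon k u) != 0 -> eact (emon k s) (fmon k v) != 0 ->
        le u v -> le (mon_mul s u) (mon_mul s v)].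

Section Initial.
Variables (k : fieldType) (n r : nat).
Local Notation E := (ext k n).
Local Notation F := (free_ext k n r).

(* Holds for no u when f = 0. *)
Definition is_leadF (le : rel (mon n r)) (f : F) (u : mon n r) : bool :=
  (mcoef f u != 0) && [forall v, (mcoef f v != 0) ==> le v u].

Definition is_leadE (le : rel {set 'I_n}) (a : E) (s : {set 'I_n}) : bool :=
  (a s != 0) && [forall t, (a t != 0) ==> le t s].

Definition initF (le : rel (mon n r)) (M : {vspace F}) : {vspace F} :=
  <<[seq fmon k u | u in [pred u | `[< exists2 f, f \in M & is_leadF le f u >]]]>>%VS.

Definition initE (le : rel {set 'I_n}) (I : {vspace E}) : {vspace E} :=
  <<[seq emon k s | s in [pred s | `[< exists2 a, a \in I & is_leadE le a s >]]]>>%VS.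

End Initial.

Definition induced_order (n r : nat) (le : rel (mon n r)) (i : 'I_r) : rel {set 'I_n} :=
  fun s t => le (i, s) (i, t).

(* Main.v *)
(* An element of F lies in M = I_1 g_1 + ... + I_r g_r iff each of its
   coordinates lies in the corresponding I_i.  The monomial e_s g_i leading f
   is also the leading monomial of f_i g_i, so the leading monomials of M are
   those of the I_i, taken together, and a subspace spanned by monomials is
   determined by the monomials it contains.  For properness, a homogeneous
   component of an element of a graded ideal remains in it, so a leading
   monomial of degree at most m is the leading monomial of an element of the
   ideal of degree at most m. *)
Require Import Defs.
From HB Require Import structures.
From mathcomp Require Import all_boot all_order all_algebra.
From mathcomp Require Import boolp.
Local Open Scope ring_scope.

Set Implicit Arguments.
Unset Strict Implicit.
Unset Printing Implicit Defensive.

Import GRing.Theory.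

(** * Complements of subsets, which index the nonzero products by a fixed monomial *)

Section SetComplement.
Variable T : finType.
Implicit Types (A B : {set T}).

Lemma subset_setUDK A B : A \subset B -> A :|: (B :\: A) = B.
Proof. by move=> sAB; rewrite -[RHS](setID B A) (setIidPr sAB). Qed.

Lemma disjoint_setUDK A B : [disjoint A & B] -> (A :|: B) :\: A = B.
Proof.
by move=> dAB; rewrite setDUl setDv set0U; apply/setDidPl; rewrite disjoint_sym.
Qed.

Lemma disjoint_setD A B : [disjoint A & B :\: A].
Proof. by rewrite -setI_eq0 setIDA setDIl setDv set0I. Qed.

End SetComplement.

(** * Coordinates, spans of monomials, and sums of components *)

Section Coordinates.
Variables (k : fieldType) (n r : nat).
Local Notation E := (ext k n).
Local Notation F := (free_ext k n r).
Implicit Types (a b : E) (f : F) (s t : {set 'I_n}) (u v : mon n r).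

Lemma coord0 s : coord_at (0 : E) s = 0.
Proof. by rewrite /coord_at ffunE. Qed.

Lemma coord_sum (T : Type) (l : seq T) (P : pred T) (g : T -> E) s :
  coord_at (\sum_(x <- l | P x) g x) s = \sum_(x <- l | P x) coord_at (g x) s.
Proof.
exact: (big_morph (fun a : E => a s) (fun a b => coordD a b s) (coord0 s)).
Qed.

Lemma free_basis f : f = \sum_u mcoef f u *: fmon k u.
Proof.
apply/ffunP => i; apply: extP => s; rewrite sum_ffunE coord_sum.
rewrite (bigD1 (i, s)) //= big1 => [|u nu]; rewrite !ffunE coordZ.
  rewrite eqxx mulr1 coord_emon eqxx addr0.
  by rewrite /mcoef mulr1.
have := mcoef_fmon k u (i, s); rewrite /mcoef /fmon !ffunE /= => ->.
by rewrite eq_sym (negbTE nu) mulr0.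
Qed.

(** The monomials form a basis, so membership depends on the support alone. Both [initE] and
    [ext_le] are such spans, and are handled through their supports from here on. *)
Lemma mem_span_emon (S : pred {set 'I_n}) a :
  reflect (forall s, a s != 0 -> S s) (a \in <<[seq emon k s | s in S]>>%VS).
Proof.
apply: (iffP idP) => [|aS].
  rewrite span_def big_image /=.
  case/memv_sumP => g gS -> s; apply: contraNT => nS.
  rewrite coord_sum big1 // => t tS; have /vlineP[x ->] := gS t tS.
  rewrite coordZ coord_emon; case: eqP => [st|_]; last by rewrite mulr0.
  by move: tS; rewrite -st unfold_in (negbTE nS).
rewrite [a]ext_basis; apply: memv_suml => s _.
have [->|/aS sS] := eqVneq (a s) 0; first by rewrite scale0r mem0v.
by apply/memvZ/memv_span/image_f.
Qed.

Lemma mem_span_fmon (S : pred (mon n r)) f :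
  reflect (forall u, mcoef f u != 0 -> S u)
    (f \in <<[seq fmon k u | u in S]>>%VS).
Proof.
apply: (iffP idP) => [|fS].
  rewrite span_def big_image /=.
  case/memv_sumP => g gS -> u; apply: contraNT => nS.
  rewrite /mcoef sum_ffunE coord_sum big1 // => v vS.
  have /vlineP[x ->] := gS v vS; rewrite ffunE coordZ.
  rewrite -/(mcoef (fmon k v) u) mcoef_fmon; case: eqP => [uv|_].
    by move: vS; rewrite -uv unfold_in (negbTE nS).
  by rewrite mulr0.
rewrite [f]free_basis; apply: memv_suml => u _.
have [->|/fS uS] := eqVneq (mcoef f u) 0; first by rewrite scale0r mem0v.
by apply/memvZ/memv_span/image_f.
Qed.

Lemma mem_ext_le m a :
  reflect (forall s, a s != 0 -> (#|s| <= m)%N) (a \in ext_le k n m).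
Proof. exact: mem_span_emon. Qed.

Lemma ext_neq0P a : reflect (exists s, a s != 0) (a != 0).
Proof.
apply: (iffP idP) => [|[s]]; last by apply: contraNneq => ->; rewrite coord0.
move=> a0; apply/existsP; apply: contraNT a0 => /existsPn a0.
by apply/eqP/extP => s; rewrite coord0; apply/eqP; rewrite -[_ == _]negbK a0.
Qed.

Lemma mulgen_genE (i j : 'I_r) a :
  mulgen (gen k n i) a j = if j == i then a else 0.
Proof.
by rewrite mulgenE !ffunE; case: (j == i :> 'I_r); rewrite ?mulr1 ?mulr0.
Qed.

Lemma mem_gen_sum (J : 'I_r -> {vspace E}) f :
  reflect (forall i, f i \in J i) (f \in \sum_i (mulgen (gen k n i) @: J i))%VS.
Proof.
apply: (iffP idP) => [|fJ].
  case/memv_sumP => g gJ -> i; rewrite sum_ffunE; apply: memv_suml => j _.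
  have /memv_imgP[a aJ ->] := gJ j isT; rewrite mulgen_genE.
  by case: eqP => [->|_]; rewrite ?mem0v.
have -> : f = \sum_i mulgen (gen k n i) (f i).
  apply/ffunP => j; rewrite sum_ffunE (bigD1 j) //= big1 => [|i ij].
    by rewrite mulgen_genE eqxx addr0.
  by rewrite mulgen_genE eq_sym (negbTE ij).
by apply: memv_suml => i _; apply: (subvP (sumv_sup i _ (subvv _))) => //; apply: memv_img.
Qed.

Lemma gen_mem_sum (J : 'I_r -> {vspace E}) (i : 'I_r) a :
  (mulgen (gen k n i) a \in \sum_i (mulgen (gen k n i) @: J i))%VS = (a \in J i).
Proof.
apply/mem_gen_sum/idP => [/(_ i)|aJ j]; rewrite mulgen_genE ?eqxx //.
by case: eqP => [->|_]; rewrite ?mem0v.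
Qed.

Lemma directv_gen_sum (J : 'I_r -> {vspace E}) :
  directv (\sum_i (mulgen (gen k n i) @: J i)).
Proof.
apply/directv_sum_independent => g gJ g0 i _.
have {}gJ j : exists a, g j = mulgen (gen k n j) a.
  by have /memv_imgP[a _ ->] := gJ j isT; exists a.
have [a gi] := gJ i; rewrite gi; move/ffunP/(_ i): g0.
rewrite sum_ffunE (bigD1 i) //= big1 => [|j ji]; last first.
  by have [b ->] := gJ j; rewrite mulgen_genE eq_sym (negbTE ji).
by rewrite gi mulgen_genE eqxx addr0 ffunE => ->; rewrite linear0.
Qed.

(** Among the terms of [a], only the one at [t :\: s] can contribute: [s :|: w = t] with [w]
    disjoint from [s] forces [w = t :\: s]. *)
Lemma coord_emonM s a t :
  coord_at (emon k s * a) t =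
  if s \subset t then (-1) ^+ inversions s (t :\: s) * a (t :\: s) else 0.
Proof.
rewrite {1}[a]ext_basis mulr_sumr coord_sum.
have term w : coord_at (emon k s * (a w *: emon k w)) t =
    if [disjoint s & w] && (t == s :|: w) then (-1) ^+ inversions s w * a w else 0.
  rewrite -scalerAr coordZ emonM; case: ifP => _ /=; last by rewrite coord0 mulr0.
  rewrite coordZ coord_emon mulrCA.
  by case: eqP => _; rewrite ?mulr1 // !mulr0.
rewrite (eq_bigr _ (fun w _ => term w)); case: ifP => st.
  rewrite (bigD1 (t :\: s)) //= big1 => [|w wt].
    by rewrite addr0 disjoint_setD subset_setUDK ?eqxx.
  case: ifP => // /andP[sw /eqP tE].
  by case/eqP: wt; rewrite tE disjoint_setUDK.
by rewrite big1 // => w _; case: ifP => // /andP[_ /eqP tE]; rewrite tE subsetUl in st.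
Qed.

End Coordinates.

(** * Initial ideals in the exterior algebra *)

Section InitialIdeal.
Variables (k : fieldType) (n : nat).
Local Notation E := (ext k n).
Implicit Types (le : rel {set 'I_n}) (I : {vspace E}) (a b : E)
  (s t u v : {set 'I_n}).

Lemma mem_initE le I a :
  reflect (forall s, a s != 0 -> exists2 b, b \in I & is_leadE le b s)
    (a \in initE le I).
Proof.
apply: (iffP (mem_span_emon _ _)) => h s /h; first by move/asboolP.
by move=> ?; apply/asboolP.
Qed.

Lemma ex_leadE le a :
  reflexive le -> transitive le -> total le -> a != 0 -> exists s, is_leadE le a s.
Proof.
move=> le_refl le_trans le_total /ext_neq0P[s0 as0].
(* [extremumP] yields a least element, so the order is reversed to obtain the greatest monomial of
   the finite support. *)
pose ge := [rel s t | le t s].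
have ge_trans : transitive ge by move=> x y z yx xz; apply: le_trans xz yx.
have ge_total : total ge by move=> x y; apply: le_total.
have [s as_ smax] := @extremumP _ _ ge s0 (fun s => a s != 0) id
  le_refl ge_trans ge_total as0.
by exists s; rewrite /is_leadE as_; apply/forall_inP => t /smax.
Qed.

(** Multiplication by [emon k s] kills the terms that meet [s] and, by compatibility, keeps the
    order of the others; the leading term survives because it is disjoint from [s]. *)
Lemma emonM_lead le a s t :
  (forall u v, [disjoint s & u] -> [disjoint s & v] ->
     le u v -> le (s :|: u) (s :|: v)) ->
  [disjoint s & t] -> is_leadE le a t -> is_leadE le (emon k s * a) (s :|: t).
Proof.
move=> le_mul st /andP[at0 /forall_inP tmax].
(* The sign is a power of -1, hence regular, so the new leading coefficient is nonzero. *)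
rewrite /is_leadE coord_emonM subsetUl disjoint_setUDK // mulrI_eq0 ?at0 /=; last first.
  by apply: lregX; apply: lregN; apply: lreg1.
apply/forall_inP => w; rewrite coord_emonM; case: ifP => [sw|]; last by rewrite eqxx.
move=> h; have aw : a (w :\: s) != 0.
  by apply: contraNneq h => ->; rewrite mulr0.
rewrite -(subset_setUDK sw).
by apply: le_mul (tmax _ aw) => //; apply: disjoint_setD.
Qed.

(** By linearity the multiplier is a monomial [emon k s]. Each monomial of the product is then [s]
    joined to a monomial leading some [c] in [I], and it leads [emon k s * c]. *)
Lemma initE_ideal le I :
  (forall s u v, [disjoint s & u] -> [disjoint s & v] ->
     le u v -> le (s :|: u) (s :|: v)) ->
  is_ideal I -> is_ideal (initE le I).
Proof.
move=> le_mul idI a b /mem_initE binit.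
rewrite [a]ext_basis mulr_suml; apply: memv_suml => s _.
rewrite -scalerAl; apply: memvZ; apply/mem_initE => t.
rewrite coord_emonM; case: ifP => [st h|]; last by rewrite eqxx.
have /binit[c cI clead] : b (t :\: s) != 0.
  by apply: contraNneq h => ->; rewrite mulr0.
exists (emon k s * c); first exact: idI.
rewrite -(subset_setUDK st).
by apply: emonM_lead => //; [exact: le_mul | exact: disjoint_setD].
Qed.

Lemma coord_hcompE j a s : hcompE j a s = if #|s| == j then a s else 0.
Proof. by rewrite /coord_at /hcompE ffunE. Qed.

Lemma initE_graded le I :
  (forall s u v, [disjoint s & u] -> [disjoint s & v] ->
     le u v -> le (s :|: u) (s :|: v)) ->
  is_ideal I -> graded_ideal (initE le I).
Proof.
move=> le_mul idI; split; first exact: initE_ideal.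
(* Taking a homogeneous component only shrinks the support. *)
move=> j a /mem_initE ainit; apply/mem_initE => s; rewrite coord_hcompE.
by case: ifP => [_ /ainit|]; rewrite ?eqxx.
Qed.

Lemma initE_cap_ext_le le I m :
  reflexive le -> transitive le -> total le -> graded_ideal I ->
  (initE le I :&: ext_le k n m = 0)%VS <-> (I :&: ext_le k n m = 0)%VS.
Proof.
move=> le_refl le_trans le_total [_ grI]; split=> cap0.
  apply/eqP; rewrite -subv0; apply/subvP => a; rewrite memv_cap memv0.
  case/andP => aI /mem_ext_le am; apply: contraT => a0.
  have [s slead] := ex_leadE le_refl le_trans le_total a0.
  have /andP[as0 _] := slead.
  (* The leading monomial belongs to the support of [a], so its degree is at most [m] as well. *)
  suff : emon k s \in (initE le I :&: ext_le k n m)%VS.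
    rewrite cap0 memv0 => /eqP/(congr1 (fun b : E => b s))/eqP.
    by rewrite coord_emon eqxx coord0 oner_eq0.
  rewrite memv_cap; apply/andP; split; [apply/mem_initE | apply/mem_ext_le] => t;
    rewrite coord_emon; case: (t =P s) => [->|]; rewrite ?eqxx // => _.
    by exists a.
  exact: am.
apply/eqP; rewrite -subv0; apply/subvP => b; rewrite memv_cap memv0.
case/andP => /mem_initE binit /mem_ext_le bm; apply: contraT => /ext_neq0P[s bs0].
have [a aI /andP[as0 _]] := binit s bs0.
(* The order need not refine the degree, so [a] may have terms of degree above [m]. Its component of
   degree [#|s|] does not, and it keeps the nonzero coefficient at [s]. *)
suff : hcompE #|s| a \in (I :&: ext_le k n m)%VS.
  rewrite cap0 memv0 => /eqP/(congr1 (fun b : E => b s))/eqP.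
  by rewrite coord_hcompE eqxx coord0 (negbTE as0).
rewrite memv_cap grI //=; apply/mem_ext_le => t; rewrite coord_hcompE.
by case: ifP => [/eqP -> _|]; rewrite ?eqxx // bm.
Qed.

End InitialIdeal.

(** * Initial submodules of the free module *)

Section InitialModule.
Variables (k : fieldType) (n r : nat) (d : 'I_r -> int).
Local Notation E := (ext k n).
Local Notation F := (free_ext k n r).
Implicit Types (le : rel (mon n r)) (M : {vspace F}) (J : 'I_r -> {vspace E}).

(** Degrees in the [i]-th summand are shifted by [d i]. The sign test matters: for negative
    [j - d i] the absolute value would select an unrelated component instead of 0. *)
Lemma hcompFE (j : int) (f : F) i :
  hcompF d j f i = if 0 <= j - d i then hcompE `|j - d i|%N (f i) else 0.
Proof.
apply: extP => s; rewrite ffunE; case: ifP => [j_ge|j_lt].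
  rewrite coord_hcompE -eqz_nat gez0_abs // -(inj_eq (addIr (d i))) subrK.
  by rewrite /coord_at ffunE.
rewrite coord0 /coord_at ffunE; case: eqP => // sj.
by rewrite -sj addrK in j_lt.
Qed.

Lemma gen_sum_ids J : (forall i, graded_ideal (J i)) ->
  ids_decomposition d (\sum_i (mulgen (gen k n i) @: J i))%VS J.
Proof.
move=> grJ; split=> //; last exact: directv_gen_sum.
split=> [a f /mem_gen_sum fJ|j f /mem_gen_sum fJ]; apply/mem_gen_sum => i.
  by rewrite ffunE; apply: (grJ i).1.
rewrite hcompFE; case: ifP => _; last exact: mem0v.
exact: (grJ i).2.
Qed.

Lemma ids_mem M J i a :
  ids_decomposition d M J -> (a \in J i) = (mulgen (gen k n i) a \in M).
Proof. by case=> _ _ -> _; rewrite gen_mem_sum. Qed.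

(** The components are determined by [M], as [J i] consists of the [a] with [a * g_i] in [M]; the
    existential in [proper_ids] can thus be tested on any given decomposition. *)
Lemma proper_idsP M J : ids_decomposition d M J ->
  proper_ids d M <-> forall i, (J i :&: ext_le k n 1 = 0)%VS.
Proof.
move=> MJ; split=> [[J' MJ' J'0] i|]; last by exists J.
suff -> : J i = J' i by [].
by apply/vspaceP => a; rewrite (ids_mem _ _ MJ) (ids_mem _ _ MJ').
Qed.

Lemma gen_sum_lead le J i s :
  (exists2 f, f \in (\sum_i (mulgen (gen k n i) @: J i))%VS & is_leadF le f (i, s))
  <-> (exists2 a, a \in J i & is_leadE (induced_order le i) a s).
Proof.
split=> [[f /mem_gen_sum fJ /andP[fs0 /forall_inP smax]] | [a aJ]].
  (* A maximum over the whole support of [f] is also one over the part in the [i]-th summand.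
     Conversely, [mulgen (gen k n i) a] has no terms in the other summands. *)
  exists (f i) => //; rewrite /is_leadE; apply/andP; split=> //.
  by apply/forall_inP => t ft; apply: (smax (i, t)).
case/andP=> as0 /forall_inP smax; exists (mulgen (gen k n i) a).
  by rewrite gen_mem_sum.
rewrite /is_leadF /mcoef /= mulgen_genE eqxx as0 /=.
apply/forall_inP => -[j t] /=; rewrite mulgen_genE.
by case: (j =P i) => [->|_]; [exact: smax | rewrite coord0 eqxx].
Qed.

Lemma initF_gen_sum le J :
  initF le (\sum_i (mulgen (gen k n i) @: J i))%VS =
  (\sum_i (mulgen (gen k n i) @: initE (induced_order le i) (J i)))%VS.
Proof.
apply/vspaceP => f; apply/mem_span_fmon/mem_gen_sum => [fin i | fin [i s] fs].
  by apply/mem_initE => s fs; apply/gen_sum_lead/asboolP/(fin (i, s)).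
by apply/asboolP/gen_sum_lead; have /mem_initE := fin i; apply.
Qed.

(** The spanning monomials also serve as generators over the exterior algebra: closure under its
    action keeps the generated submodule inside the span. *)
Lemma span_fmon_monomial (S : pred (mon n r)) :
  is_submodule <<[seq fmon k u | u in S]>>%VS ->
  monomial_submodule <<[seq fmon k u | u in S]>>%VS.
Proof.
move=> subS; exists [set u | S u]; apply/eqP; rewrite eqEsubv; apply/andP; split.
  apply/span_subvP => _ /imageP[u uS ->].
  have uS' : u \in [set u | S u] by rewrite inE.
  apply: (subvP (sumv_sup u uS' (subvv _))); apply/memv_imgP; exists 1.
    exact: memvf.
  by rewrite mulgenE; apply/ffunP => i; rewrite !ffunE mul1r.
apply/subv_sumP => u; rewrite inE => uS; apply/subvP => _ /memv_imgP[a _ ->].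
by rewrite mulgenE; apply/subS/memv_span/image_f.
Qed.

(** Passes from the nonvanishing condition of [monomial_order] to disjointness: a disjoint product
    is a signed basis monomial, hence nonzero. *)
Lemma monomial_order_induced le i (s u v : {set 'I_n}) :
  monomial_order k le -> [disjoint s & u] -> [disjoint s & v] ->
  induced_order le i u v -> induced_order le i (s :|: u) (s :|: v).
Proof.
have neq0 (w : {set 'I_n}) : [disjoint s & w] -> eact (emon k s) (fmon k (i, w)) != 0.
  move=> sw; rewrite eact_fmon sw scaler_eq0 signr_eq0 /=.
  apply/eqP => /(congr1 (fun f : F => mcoef f (mon_mul s (i, w))))/eqP.
  by rewrite mcoef_fmon eqxx /mcoef ffunE coord0 oner_eq0.
by move=> [_ _ _ _ le_mul] /neq0 su /neq0 sv; apply: le_mul.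
Qed.

End InitialModule.

(** * Splitting and properness of the initial submodule *)

Theorem proposition29 (k : fieldType) (n r : nat) (d : 'I_r -> int)
    (M : {vspace free_ext k n r}) (I : 'I_r -> {vspace ext k n})
    (hM : ids_decomposition d M I)
    (le : rel (mon n r)) (hle : monomial_order k le) :
  ([/\ initF le M =
         (\sum_i (mulgen (gen k n i) @: initE (induced_order le i) (I i)))%VS,
       directv (\sum_i (mulgen (gen k n i) @: initE (induced_order le i) (I i)))%VS,
       monomial_submodule (initF le M)
     & ids_decomposition d (initF le M)
         (fun i => initE (induced_order le i) (I i))])
  /\
  ((proper_ids d (initF le M) <-> proper_ids d M)
   /\ (amata_crupi d (initF le M) <-> proper_ids d M)).
Proof.
have [_ grI MI _] := hM; have [le_refl _ le_trans le_total _] := hle.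
have initM : initF le M =
    (\sum_i (mulgen (gen k n i) @: initE (induced_order le i) (I i)))%VS.
  by rewrite MI initF_gen_sum.
have ids_init : ids_decomposition d (initF le M)
    (fun i => initE (induced_order le i) (I i)).
  rewrite initM; apply: gen_sum_ids => i.
  apply: initE_graded (grI i).1 => s u v.
  exact: monomial_order_induced hle.
have mon_init : monomial_submodule (initF le M).
  by apply: span_fmon_monomial; have [[]] := ids_init.
have proper_init : proper_ids d (initF le M) <-> proper_ids d M.
  apply: (iff_trans (proper_idsP ids_init)).
  apply: iff_trans (iff_sym (proper_idsP hM)).
  (* Properness is compared component by component with degree bound 1; each induced order inherits
     reflexivity, transitivity and totality from [le]. *)
  have capE i := initE_cap_ext_le (le := induced_order le i) 1
    (fun s => le_refl (i, s)) (fun s t u => le_trans (i, s) (i, t) (i, u))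
    (fun s t => le_total (i, s) (i, t)) (grI i).
  by split=> cap0 i; apply/capE.
split; first by split=> //; apply: directv_gen_sum.
(* The monomial half of [amata_crupi] always holds by [mon_init], leaving only properness. *)
by split=> //; split=> [[_ /proper_init]|/proper_init].
Qed.
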